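(* There is an absolute constant $c>0$ such that for all $n$ and all $\varepsilon$ with $c>\varepsilon\ge 2^{-n^{0.49}}$, any non-adaptive (possibly two-sided error) $\varepsilon$-testing algorithm for whether an unknown $f:\{0,1\}^n\to\{0,1\}$ is union-closed versus $\varepsilon$-far from union-closed must make $n^{\Omega(\log(1/\varepsilon))}$ queries to $f$.
   Context: Identify $x\in\{0,1\}^n$ with the subset $\{i:x_i=1\}$ of $[n]$. A function $f:\{0,1\}^n\to\{0,1\}$ is union-closed if whenever $f(x)=f(y)=1$ we have $f(x\cup y)=1$, where $x\cup y$ is the coordinatewise OR. The distance between $f,g$ is $\Pr_{\mathbf{x}}[f(\mathbf{x})\ne g(\mathbf{x})]$ for uniform $\mathbf{x}$; $f$ is $\varepsilon$-far from union-closed if its distance to every union-closed function is at least $\varepsilon$. An $\varepsilon$-testing algorithm accepts with probability at least $2/3$ every union-closed $f$ and rejects with probability at least $2/3$ every $f$ that is $\varepsilon$-far from union-closed; it is non-adaptive if its queries do not depend on answers to earlier queries. *)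

(* Defs.v *)
From mathcomp Require Import all_boot all_order all_algebra.
From mathcomp Require Import reals exp.

Set Implicit Arguments.
Unset Strict Implicit.
Unset Printing Implicit Defensive.

Import Order.TTheory GRing.Theory Num.Theory.

Local Open Scope ring_scope.

(* Points of the cube {0,1}^n are identified with subsets of [n]; the
   coordinatewise OR is then the union. *)
Definition cube (n : nat) : finType := {set 'I_n}.

Definition boolfun (n : nat) : finType := {ffun cube n -> bool}.

Definition union_closed (n : nat) (f : boolfun n) : Prop :=
  forall x y : {set 'I_n}, f x = true -> f y = true -> f (x :|: y) = true.

Definition dist (R : realType) (n : nat) (f g : boolfun n) : R :=
  #|[set x : cube n | f x != g x]|%:R / #|cube n|%:R.

Definition far_from_union_closed (R : realType) (n : nat) (eps : R)
    (f : boolfun n) : Prop :=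
  forall g : boolfun n, union_closed g -> eps <= dist R f g.

(* A deterministic non-adaptive algorithm: the query points, fixed in advance,
   and the verdict (true = accept) as a function of the answers. Query points
   may repeat, so algorithms making fewer than q queries are included. *)
Definition det_algorithm (n q : nat) : finType :=
  (q.-tuple (cube n) * {ffun q.-tuple bool -> bool})%type.

Definition det_accepts (n q : nat) (A : det_algorithm n q) (f : boolfun n) :
    bool :=
  A.2 [tuple of map f A.1].

(* The queries and the verdict may share randomness. As [det_algorithm n q] is
   finite, any source of randomness induces a distribution of this form. *)
Record nonadaptive_algorithm (R : realType) (n q : nat) :=
  NonadaptiveAlgorithm {
    weight : det_algorithm n q -> R;
    weight_ge0 : forall A, 0 <= weight A;
    weight_sum1 : \sum_A weight A = 1
  }.

Definition pr_accept (R : realType) (n q : nat)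
    (T : nonadaptive_algorithm R n q) (f : boolfun n) : R :=
  \sum_(A | det_accepts A f) weight T A.

Definition pr_reject (R : realType) (n q : nat)
    (T : nonadaptive_algorithm R n q) (f : boolfun n) : R :=
  \sum_(A | ~~ det_accepts A f) weight T A.

Definition tests_union_closed (R : realType) (n q : nat) (eps : R)
    (T : nonadaptive_algorithm R n q) : Prop :=
  (forall f : boolfun n, union_closed f -> 2 / 3 <= pr_accept T f) /\
  (forall f : boolfun n, far_from_union_closed eps f -> 2 / 3 <= pr_reject T f).

Definition log2 (R : realType) (x : R) : R := ln x / ln 2.

(* Main.v *)
Require Import Defs.
From mathcomp Require Import all_boot all_order all_algebra.
From mathcomp Require Import reals exp.
From mathcomp Require Import sequences zify ring lra.

(** Write [n = m + 1]; coordinate [ord0] is a selector bit [c], the other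
    coordinates form a set [x] in ['I_m]. Draw [2 ^ (t - 1)] random regions, each
    made of a term [T_i] of [t ~ sqrt n / 8] coordinates and two blocks [A_i],
    [B_i] of [k ~ log (1 / eps) / 256] coordinates, together with a random bit
    [b_i]. The function is [1] if [2 |x| > m] or [x] contains two terms, [0] if
    [x] contains no term; if [T_i] is the only term in [x], it is [0] unless [x]
    is constant on [A_i] and on [B_i], and then it is [b_i + c] in the "yes" case
    and [b_i + c + (A_i and B_i are included in x)] in the "no" case (mod 2).

    Yes-functions are union-closed, since within a region the ones share the
    same selector bit. In a no-function, whatever [b_i], taking [c = b_i + 1] and
    emptying one block or the other in a point [x] that contains both gives two
    ones whose union is a zero.

    The two cases differ only by a flip of the [b_i], so they are
    indistinguishable unless two queries [x], [y] of weight at most [m / 2] lie in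
    a common term [T_i] while a whole block lies in the difference of [x] and
    [y]. If the difference has size [d * m], this has probability at most
    [(1 - 2 d) ^ t * d ^ k <= (k / 2 t) ^ k], the exponent of which beats all the
    losses [2 ^ O(k)]. This makes it unnecessary to show that most no-functions
    are far: it is enough that a fraction [2 ^ - O(k)] of the choices of regions
    are [2 ^ - O(k)]-far, which follows from an average. *)

Set Implicit Arguments.
Unset Strict Implicit.
Unset Printing Implicit Defensive.

Import Order.TTheory GRing.Theory Num.Theory.

(** * Talagrand functions with hidden blocks *)

Section TalagrandFunctions.
Variables (V I : finType) (T A B : I -> {set V}).

Definition satisfied (x : {set V}) : {set I} := [set i | T i \subset x].

Definition constant_on (D x : {set V}) : bool :=
  (D \subset x) || [disjoint D & x].

Definition full (i : I) (x : {set V}) : bool := A i :|: B i \subset x.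

(** [mode] is false in the yes-case and true in the no-case; [c] is the selector bit. *)
Definition term_value (mode : bool) (b : {ffun I -> bool}) (i : I) (c : bool)
    (x : {set V}) : bool :=
  [&& constant_on (A i) x, constant_on (B i) x &
      b i (+) c (+) (mode && full i x)].

Definition talagrand (mode : bool) (b : {ffun I -> bool}) (c : bool)
    (x : {set V}) : bool :=
  [|| #|V| < 2 * #|x|, 1 < #|satisfied x| |
      [exists i in satisfied x, term_value mode b i c x]].

Lemma satisfiedS (x y : {set V}) :
  x \subset y -> satisfied x \subset satisfied y.
Proof.
by move=> xy; apply/subsetP => i; rewrite !inE => /subset_trans; apply.
Qed.

Lemma constant_onU (D x y : {set V}) :
  constant_on D x -> constant_on D y -> constant_on D (x :|: y).
Proof.
rewrite /constant_on => /orP[Dx|Dx] /orP[Dy|Dy].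
- by rewrite (subset_trans Dx) ?subsetUl.
- by rewrite (subset_trans Dx) ?subsetUl.
- by rewrite (subset_trans Dy) ?subsetUr.
- apply/orP; right; rewrite -setI_eq0 setIUr.
  by move: Dx Dy; rewrite -!setI_eq0 => /eqP-> /eqP->; rewrite setU0.
Qed.

(** Unless the union is trivially a one, it contains at most one term, so [x] and [y] are ones
    through the same term [T i]. Both selectors then equal [~~ b i], and so does their disjunction,
    which is the selector of the union. *)
Lemma talagrand_union_closed (b : {ffun I -> bool}) (c c' : bool)
    (x y : {set V}) :
  talagrand false b c x -> talagrand false b c' y ->
  talagrand false b (c || c') (x :|: y).
Proof.
move=> fx fy; rewrite /talagrand.
have [//|small] := boolP (#|V| < 2 * #|x :|: y|) => /=.
have [//|le1] := boolP (1 < #|satisfied (x :|: y)|) => /=.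
have reduce (z : {set V}) d : z \subset x :|: y -> talagrand false b d z ->
    exists2 i, i \in satisfied z & term_value false b i d z.
  move=> sub; rewrite /talagrand.
  have /subset_leq_card sz := sub.
  have /subset_leq_card ss := satisfiedS sub.
  have /negbTE-> : ~~ (#|V| < 2 * #|z|) by lia.
  have /negbTE-> : ~~ (1 < #|satisfied z|) by lia.
  by move=> /existsP[i /andP[]]; exists i.
have [i ix vx] := reduce _ _ (subsetUl x y) fx.
have [j jy vy] := reduce _ _ (subsetUr x y) fy.
have ixy := subsetP (satisfiedS (subsetUl x y)) _ ix.
have jxy := subsetP (satisfiedS (subsetUr x y)) _ jy.
have ij : i = j.
  by move: le1; rewrite -leqNgt => /card_le1_eqP; apply.
subst j; apply/existsP; exists i; rewrite ixy /=.
move: vx vy => /and3P[Ax Bx]; rewrite /= addbF => bx.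
move=> /and3P[Ay By]; rewrite /= addbF => by_.
rewrite /term_value !constant_onU //= addbF.
by move: bx by_; case: (b i); case: c {fx}; case: c' {fy}.
Qed.

Definition live (x : {set V}) : bool := 2 * #|x| <= #|V|.

Definition separated (x y : {set V}) (i : I) : bool :=
  (T i \subset x :&: y) && ((A i \subset x :\: y) || (B i \subset x :\: y)).

(* Flipping the bit of every region in which some point of [s] contains both
   blocks makes the no-values on [s] equal to the yes-values. *)
Definition flips (s : seq {set V}) (b : {ffun I -> bool}) : {ffun I -> bool} :=
  [ffun i => b i (+) has (fun x => [&& live x, T i \subset x & full i x]) s].

Lemma flipsK (s : seq {set V}) : involutive (flips s).
Proof. by move=> b; apply/ffunP => i; rewrite !ffunE addbK. Qed.

(** Let [x] be constant on both blocks of a region whose term it contains. If some live [y] in [s]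
    contains that term and both blocks, so does [x]: otherwise it would miss a whole block and the
    pair would be separated. Hence the flip at [i] is exactly [full i x] and cancels the extra
    summand of the no-case. If [x] is not constant on the blocks, the bit does not matter. *)
Lemma talagrand_flips (s : seq {set V}) (b : {ffun I -> bool}) (c : bool)
    (x : {set V}) :
  (forall y z i, y \in s -> z \in s -> live y -> live z -> ~~ separated y z i) ->
  x \in s ->
  talagrand true (flips s b) c x = talagrand false b c x.
Proof.
move=> sepN xs; rewrite /talagrand.
have [//|small] := boolP (#|V| < 2 * #|x|) => /=.
have lx : live x by rewrite /live leqNgt.
congr (_ || _); apply: eq_existsb => i; rewrite inE.
case: (boolP (T i \subset x)) => //= Tx.
rewrite /term_value; case: (boolP (constant_on (A i) x)) => //= cA.
case: (boolP (constant_on (B i) x)) => //= cB.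
rewrite ffunE addbF -!addbA; congr (_ (+) _); rewrite addbCA.
suff -> : has (fun y => [&& live y, T i \subset y & full i y]) s = full i x.
  by rewrite addbb addbF.
apply/hasP/idP => [[y ys /and3P[ly Ty fy]]|fx]; last first.
  by exists x => //; rewrite lx Tx fx.
have := sepN y x i ys xs ly lx; rewrite /separated subsetI Ty Tx /= => /norP[].
move: fy; rewrite /full !subUset => /andP[Ay By].
rewrite !subsetD Ay By /= => nA nB.
by move: cA cB; rewrite /constant_on (negbTE nA) (negbTE nB) !orbF => -> ->.
Qed.

(** Disjointness allows one block to be removed from [x] without touching the term or the other
    block. *)
Definition witness (x : {set V}) : bool :=
  live x && [exists i, [&& satisfied x == [set i], full i x,
    [disjoint T i & A i], [disjoint T i & B i] & [disjoint A i & B i]]].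

(** For a suitable selector, [x :\: A i] and [x :\: B i] are ones whose union [x] is a zero, so [g]
    disagrees at one of these three points. Each of them determines [x], so distinct witnesses yield
    distinct disagreements. *)
Lemma card_witness_le (b : {ffun I -> bool}) (g : bool -> {set V} -> bool) :
  (forall i, A i != set0) -> (forall i, B i != set0) ->
  (forall c x y, g c x -> g c y -> g c (x :|: y)) ->
  #|[set x | witness x]| <=
  #|[set p : bool * {set V} | talagrand true b p.1 p.2 != g p.1 p.2]|.
Proof.
move=> An0 Bn0 gU; set diff := [set p : bool * {set V} | _].
(* Recovers the witness [x] from any of the points [x], [x :\: A i], [x :\: B i] *)
pose fill (p : bool * {set V}) :=
  p.2 :|: \bigcup_(i in satisfied p.2) (A i :|: B i).
suff /subset_leq_card h : [set x | witness x] \subset fill @: diff.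
  by apply: leq_trans h _; apply: leq_imset_card.
apply/subsetP => x; rewrite inE => /andP[lx /existsP[i]].
move=> /and5P[/eqP sx fx TA TB AB].
have [Ax Bx] : A i \subset x /\ B i \subset x.
  by move: fx; rewrite /full subUset => /andP[].
have Tx : T i \subset x by have := set11 i; rewrite -sx inE.
have satE (y : {set V}) : T i \subset y -> y \subset x -> satisfied y = [set i].
  move=> Ty yx; apply/eqP; rewrite eqEsubset -{1}sx satisfiedS //=.
  by rewrite sub1set inE.
have liveE (y : {set V}) : y \subset x -> live y.
  by rewrite /live => /subset_leq_card; move: lx; rewrite /live; lia.
have talE (y : {set V}) c : T i \subset y -> y \subset x ->
    talagrand true b c y = term_value true b i c y.
  move=> Ty yx; rewrite /talagrand satE // cards1 /=.
  have := liveE _ yx; rewrite /live ltnNge => -> /=; apply/existsP/idP => [[j]|].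
    by rewrite inE => /andP[/eqP->].
  by move=> v; exists i; rewrite set11.
(* With this selector the value is 1 once a block is emptied, and [full i x] turns it into 0 at
   [x]. *)
pose c := ~~ b i.
have TxA : T i \subset x :\: A i by rewrite subsetD Tx.
have TxB : T i \subset x :\: B i by rewrite subsetD Tx.
have disjA (D y : {set V}) : [disjoint D & y :\: D].
  by rewrite -setI_eq0 setIDA setD_eq0 subsetIl.
have nsub (D y : {set V}) : D != set0 -> ~~ (D \subset y :\: D).
  by rewrite subsetD => Dn; rewrite -setI_eq0 setIid (negbTE Dn) andbF.
have tA : talagrand true b c (x :\: A i).
  rewrite talE ?subsetDl // /term_value /constant_on disjA orbT /=.
  rewrite subsetD Bx disjoint_sym AB /= /full subUset (negbTE (nsub _ _ _)) //=.
  by rewrite /c; case: (b i).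
have tB : talagrand true b c (x :\: B i).
  rewrite talE ?subsetDl // /term_value /constant_on disjA orbT /=.
  rewrite subsetD Ax AB /= /full subUset andbC (negbTE (nsub _ _ _)) //=.
  by rewrite /c; case: (b i).
have tx : talagrand true b c x = false.
  rewrite talE // /term_value /constant_on Ax Bx fx /= /c.
  by case: (b i).
have fillE (y : {set V}) : T i \subset y -> y \subset x ->
    x \subset y :|: (A i :|: B i) -> fill (c, y) = x.
  move=> Ty yx xy; rewrite /fill /= satE // big_set1.
  by apply/eqP; rewrite eqEsubset xy subUset yx -[A i :|: B i \subset x]/(full i x) fx.
have imP (y : {set V}) : T i \subset y -> y \subset x ->
    x \subset y :|: (A i :|: B i) -> talagrand true b c y != g c y -> x \in fill @: diff.
  move=> Ty yx xy neq; apply/imsetP; exists (c, y); rewrite ?inE //.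
  by rewrite fillE.
have covA : x \subset (x :\: A i) :|: (A i :|: B i).
  by apply/subsetP => v; rewrite !inE => ->; case: (v \in A i).
have covB : x \subset (x :\: B i) :|: (A i :|: B i).
  by apply/subsetP => v; rewrite !inE => ->; case: (v \in B i); rewrite ?orbT.
have [gA|] := eqVneq (talagrand true b c (x :\: A i)) (g c (x :\: A i)); last first.
  by apply: imP; rewrite ?subsetDl.
have [gB|] := eqVneq (talagrand true b c (x :\: B i)) (g c (x :\: B i)); last first.
  by apply: imP; rewrite ?subsetDl.
apply: (imP x) => //; first exact: subsetUl.
have := gU c (x :\: A i) (x :\: B i); rewrite -gA -gB tA tB => /(_ isT isT).
have -> : (x :\: A i) :|: (x :\: B i) = x.
  by rewrite -setDIr (disjoint_setI0 AB) setD0.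
by rewrite tx => ->.
Qed.

End TalagrandFunctions.

(** * Counting random regions *)

(** Counting form of independence of the coordinates of a random family. *)
Lemma card_ffun_at (I W : finType) (i : I) (E E' : {pred W}) :
  #|[set f : {ffun I -> W} | (f i \in E) && [forall (j | j != i), f j \in E']]|
  = #|E| * #|E'| ^ #|I|.-1.
Proof.
pose F j : pred W := if j == i then mem E else mem E'.
have -> : #|[set f : {ffun I -> W} |
    (f i \in E) && [forall (j | j != i), f j \in E']]| =
    #|(family F : pred {ffun I -> W})|.
  rewrite cardsE; apply: eq_card => f; rewrite !inE.
  apply/andP/familyP => [[fi /forall_inP fj] j|fF].
    by rewrite /F; case: eqVneq => [->|/fj].
  split; first by have := fF i; rewrite /F eqxx.
  by apply/forall_inP => j ji; have := fF j; rewrite /F (negbTE ji).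
rewrite card_family foldrE big_image (bigD1 i) //= {1}/F eqxx; congr (_ * _).
rewrite -(cardC1 i) -prod_nat_const; apply: eq_bigr => j ji.
by rewrite /F (negbTE ji).
Qed.

Lemma card_ffun_image_sub (J V : finType) (x : {set V}) :
  #|[set f : {ffun J -> V} | f @: [set: J] \subset x]| = #|x| ^ #|J|.
Proof.
rewrite -card_ffun_on cardsE; apply: eq_card => f; rewrite !inE.
apply/subsetP/ffun_onP => [fx j|fx _ /imsetP[j _ ->]] //.
by apply: fx; apply: imset_f.
Qed.

(** * Elementary real inequalities *)

Section Bernoulli.
Variable R : realFieldType.
Local Open Scope ring_scope.

Lemma bernoulli (x : R) (n : nat) : 0 <= x <= 1 -> 1 - n%:R * x <= (1 - x) ^+ n.
Proof.
move=> /andP[x0 x1]; elim: n => [|n IH]; first by rewrite mul0r subr0 expr0.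
rewrite exprS; have : (1 - x) * (1 - n%:R * x) <= (1 - x) * (1 - x) ^+ n.
  by rewrite ler_wpM2l // subr_ge0.
apply: le_trans; rewrite -natr1.
have : 0 <= n%:R * x * x :> R by rewrite !mulr_ge0.
lra.
Qed.

End Bernoulli.

Section Exponential.
Variable R : realType.
Local Open Scope ring_scope.

(** Apply [1 + z <= expR z] twice: [1 - 2 * d <= expR (- (2 * d))], and [z <= expR z] at
    [z = 2 * d * t / k]. The two exponentials cancel, so the bound is uniform in [d]. *)
Lemma pow_mul_pow_le (t k : nat) (d : R) : (0 < t)%N -> (0 < k)%N ->
  0 <= d -> 2 * d <= 1 ->
  (1 - 2 * d) ^+ t * d ^+ k <= (k%:R / (2 * t%:R)) ^+ k.
Proof.
move=> t0 k0 d0 d1.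
have tR : 0 < t%:R :> R by rewrite ltr0n.
have kR : 0 < k%:R :> R by rewrite ltr0n.
have e1 : (1 - 2 * d) ^+ t <= expR (- (2 * d * t%:R)).
  have -> : expR (- (2 * d * t%:R)) = expR (- (2 * d)) ^+ t.
    by rewrite -expRM_natr mulNr.
  rewrite lerXn2r ?nnegrE ?expR_ge0 ?subr_ge0 //.
  exact: expR_ge1Dx.
have e2 : (2 * d * t%:R / k%:R) ^+ k <= expR (2 * d * t%:R).
  have -> : 2 * d * t%:R = (2 * d * t%:R / k%:R) * k%:R by field; lra.
  rewrite expRM_natr mulfK ?gt_eqF // lerXn2r ?nnegrE ?expR_ge0 //.
    by rewrite !mulr_ge0 // invr_ge0 ltW.
  by apply: le_trans (expR_ge1Dx _); lra.
have -> : d ^+ k = (2 * d * t%:R / k%:R) ^+ k * (k%:R / (2 * t%:R)) ^+ k.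
  by rewrite -exprMn; congr (_ ^+ k); field; rewrite !gt_eqF.
rewrite mulrA ler_piMl //.
  by rewrite exprn_ge0 // divr_ge0 // ?mulr_ge0 // ltW.
apply: (@le_trans _ _ (expR (- (2 * d * t%:R)) * expR (2 * d * t%:R))); last first.
  by rewrite -expRD addNr expR0.
by rewrite ler_pM // exprn_ge0 // ?subr_ge0 // divr_ge0 // ?mulr_ge0 // ltW.
Qed.
End Exponential.

(** * Double counting, unions of events and successive choices *)

Lemma card_set_sum (W : finType) (P : pred W) : #|[set w | P w]| = \sum_w P w.
Proof. by rewrite -sum1dep_card big_mkcond; apply: eq_bigr => w _; case: (P w). Qed.

Lemma card_exists_le (I W : finType) (P : I -> pred W) :
  #|[set w | [exists i, P i w]]| <= \sum_i #|[set w | P i w]|.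
Proof.
under eq_bigr do rewrite card_set_sum.
rewrite card_set_sum exchange_big; apply: leq_sum => w _.
by case: existsP => // -[i Pi]; rewrite (bigD1 i) //= Pi.
Qed.

Lemma sum_card_le_exists (I W : finType) (P : I -> pred W) :
  (forall w i j, P i w -> P j w -> i = j) ->
  \sum_i #|[set w | P i w]| <= #|[set w | [exists i, P i w]]|.
Proof.
move=> uniq; under eq_bigr do rewrite card_set_sum.
rewrite card_set_sum exchange_big; apply: leq_sum => w _.
case: existsP => [[i Pi]|nP].
  rewrite (bigD1 i) //= Pi big1 // => j ji.
  by apply/eqP; rewrite eqb0; apply: contraNN ji => /uniq/(_ Pi)->.
by rewrite big1 // => i _; apply/eqP; rewrite eqb0; apply/negP => Pi; case: nP;
   exists i.
Qed.

Lemma card_dep_pair_ge (U W : finType) (P : pred U) (Q : U -> pred W) (c : nat) :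
  (forall u, P u -> c <= #|[set w | Q u w]|) ->
  #|[set u | P u]| * c <= #|[set p : U * W | P p.1 && Q p.1 p.2]|.
Proof.
move=> Qc; rewrite -[leqRHS]sum1dep_card -(pair_big_dep _ _ (fun _ _ => 1)) /=.
rewrite -sum_nat_const.
under eq_bigl do rewrite inE.
by apply: leq_sum => u Pu; rewrite sum1dep_card; apply: Qc.
Qed.

Lemma leq_exp (a b n : nat) : a <= b -> a ^ n <= b ^ n.
Proof. by case: n => // n; rewrite leq_exp2r. Qed.

(** * Counting regions and families of regions *)

Section Regions.
Variables (V : finType) (t k : nat).

(** Coordinates are drawn with repetition, so a term or block may have fewer than [t] or [k]
    elements; in exchange, inclusion events have exact power counts. *)
Definition region : finType :=
  ({ffun 'I_t -> V} * ({ffun 'I_k -> V} * {ffun 'I_k -> V}))%type.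

Definition term (r : region) : {set V} := r.1 @: [set: 'I_t].
Definition block1 (r : region) : {set V} := r.2.1 @: [set: 'I_k].
Definition block2 (r : region) : {set V} := r.2.2 @: [set: 'I_k].

Lemma card_region : #|{: region}| = #|V| ^ t * (#|V| ^ k * #|V| ^ k).
Proof. by rewrite !card_prod !card_ffun !card_ord. Qed.

Lemma card_term_sub (x : {set V}) :
  #|[set r | term r \subset x]| = #|x| ^ t * (#|V| ^ k * #|V| ^ k).
Proof.
have -> : [set r | term r \subset x] =
    setX [set f : {ffun 'I_t -> V} | f @: [set: 'I_t] \subset x] setT.
  by apply/setP => r; rewrite !inE andbT.
by rewrite cardsX card_ffun_image_sub cardsT card_prod !card_ffun !card_ord.
Qed.

Lemma card_separating_le (x y : {set V}) :
  #|[set r | (term r \subset x) && ((block1 r \subset y) || (block2 r \subset y))]|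
  <= #|x| ^ t * (2 * (#|y| ^ k * #|V| ^ k)).
Proof.
pose X := [set f : {ffun 'I_t -> V} | f @: [set: 'I_t] \subset x].
pose Y := [set f : {ffun 'I_k -> V} | f @: [set: 'I_k] \subset y].
have -> : [set r | (term r \subset x) &&
      ((block1 r \subset y) || (block2 r \subset y))] =
    setX X (setX Y setT :|: setX setT Y).
  by apply/setP => r; rewrite !inE andbT.
rewrite cardsX card_ffun_image_sub card_ord leq_mul2l; apply/orP; right.
apply: leq_trans (leq_card_setU _ _) _.
rewrite !cardsX card_ffun_image_sub cardsT card_ffun !card_ord.
by rewrite mul2n -addnn [#|V| ^ k * _]mulnC.
Qed.

Definition inscribed (x : {set V}) (r : region) : bool :=
  [&& term r \subset x, block1 r :|: block2 r \subset x, [disjoint term r & block1 r],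
      [disjoint term r & block2 r] & [disjoint block1 r & block2 r]].

(** Choose the term in [x], then the first block outside the term, then the second block outside
    both; what has been chosen removes at most [t], then [t + k], elements. *)
Lemma card_inscribed_ge (x : {set V}) :
  #|x| ^ t * ((#|x| - t) ^ k * (#|x| - t - k) ^ k) <= #|[set r | inscribed x r]|.
Proof.
have card_im j (f : {ffun 'I_j -> V}) : #|f @: [set: 'I_j]| <= j.
  by apply: leq_trans (leq_imset_card _ _) _; rewrite cardsT card_ord.
have cardI j (f : {ffun 'I_j -> V}) (y : {set V}) : #|y :&: f @: [set: 'I_j]| <= j.
  by apply: leq_trans (card_im j f); apply/subset_leq_card/subsetIr.
rewrite -{1}(card_ord t) -card_ffun_image_sub.
pose Q2 (f : {ffun 'I_t -> V}) (g h : {ffun 'I_k -> V}) :=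
  h @: [set: 'I_k] \subset (x :\: f @: [set: 'I_t]) :\: g @: [set: 'I_k].
pose Q1 (f : {ffun 'I_t -> V}) (p : {ffun 'I_k -> V} * {ffun 'I_k -> V}) :=
  (p.1 @: [set: 'I_k] \subset x :\: f @: [set: 'I_t]) && Q2 f p.1 p.2.
apply: (@leq_trans #|[set r : region | (r.1 @: [set: 'I_t] \subset x) && Q1 r.1 r.2]|);
  last first.
  apply/subset_leq_card/subsetP => -[f [g h]].
  rewrite !inE /Q1 /Q2 /inscribed /term /block1 /block2 /= !subsetD.
  move=> /and3P[fx /andP[gx fg] /andP[/andP[hx fh] gh]].
  by rewrite subUset fx gx hx !(disjoint_sym (f @: _)) fg fh disjoint_sym gh.
apply: card_dep_pair_ge => f fx.
apply: (@leq_trans (#|[set g : {ffun 'I_k -> V} |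
    g @: [set: 'I_k] \subset x :\: f @: [set: 'I_t]]| * (#|x| - t - k) ^ k)).
  rewrite card_ffun_image_sub card_ord leq_mul2r; apply/orP; right.
  by rewrite cardsD leq_exp // leq_sub2l.
apply: card_dep_pair_ge => g gx; rewrite card_ffun_image_sub card_ord.
by rewrite leq_exp // !cardsD !leq_sub // ?leq_sub2l.
Qed.

Definition terms (I : finType) (w : {ffun I -> region}) i := term (w i).
Definition blocks1 (I : finType) (w : {ffun I -> region}) i := block1 (w i).
Definition blocks2 (I : finType) (w : {ffun I -> region}) i := block2 (w i).

Lemma card_separated_le (I : finType) (x y : {set V}) :
  #|[set w : {ffun I -> region} |
     [exists i, separated (terms w) (blocks1 w) (blocks2 w) x y i]]| <=
  #|I| * (#|x :&: y| ^ t * (2 * (#|x :\: y| ^ k * #|V| ^ k)) * #|{: region}| ^ #|I|.-1).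
Proof.
apply: leq_trans (card_exists_le _) _.
rewrite -sum_nat_const; apply: leq_sum => i _.
apply: (@leq_trans (#|[set r | (term r \subset x :&: y) &&
   ((block1 r \subset x :\: y) || (block2 r \subset x :\: y))]| *
   #|{: region}| ^ #|I|.-1)).
  rewrite -(card_ffun_at i); apply/subset_leq_card/subsetP => w.
  by rewrite !inE => sep; apply/andP; split=> //; apply/forall_inP.
by rewrite leq_mul2r card_separating_le orbT.
Qed.

(** For distinct [i], the events that region [i] is inscribed in [x] and no other term lies in [x]
    are disjoint, so their counts add up. *)
Lemma card_witness_ge (I : finType) (x : {set V}) : 0 < k -> live x ->
  #|I| * ((#|x| ^ t * ((#|x| - t) ^ k * (#|x| - t - k) ^ k)) *
    (#|{: region}| - #|x| ^ t * (#|V| ^ k * #|V| ^ k)) ^ #|I|.-1) <=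
  #|[set w : {ffun I -> region} |
     witness (terms w) (blocks1 w) (blocks2 w) x]|.
Proof.
move=> k0 lx.
pose P i (w : {ffun I -> region}) := inscribed x (w i) &&
  [forall (j | j != i), ~~ (term (w j) \subset x)].
have uniqP w i j : P i w -> P j w -> i = j.
  move=> /andP[/and5P[ix _ _ _ _] _] /andP[_ /forall_inP nj].
  by apply/eqP; apply: contraLR ix => /nj.
apply: (@leq_trans #|[set w | [exists i, P i w]]|); last first.
  apply/subset_leq_card/subsetP => w; rewrite !inE => /existsP[i].
  move=> /andP[/and5P[Tx Fx TA TB AB] /forall_inP nj].
  rewrite /witness lx; apply/existsP; exists i; apply/and5P; split => //.
  apply/eqP/setP => j; rewrite !inE; case: eqVneq => [->//|ji].
  exact/negbTE/nj.
apply: leq_trans (sum_card_le_exists uniqP).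
rewrite -sum_nat_const; apply: leq_sum => i _.
apply: (@leq_trans (#|[set r | inscribed x r]| *
    #|[set r : region | ~~ (term r \subset x)]| ^ #|I|.-1)); last first.
  rewrite -(card_ffun_at i); apply/subset_leq_card/subsetP => w.
  rewrite !inE /P => /andP[-> /forall_inP nj]; apply/forall_inP => j /nj.
  by rewrite inE.
rewrite leq_mul ?card_inscribed_ge // leq_exp //.
have -> : [set r : region | ~~ (term r \subset x)] = ~: [set r | term r \subset x].
  by apply/setP => r; rewrite !inE.
by rewrite -(cardsC [set r | term r \subset x]) card_term_sub addKn.
Qed.

End Regions.

(** * Middle layers of the cube, by the second moment *)

Lemma card_sets (V : finType) : #|{set V}| = 2 ^ #|V|.
Proof. by rewrite -[in RHS]cardsT -card_powerset powersetT cardsT. Qed.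

Section MiddleLayers.
Variable V : finType.
Local Open Scope ring_scope.

Let dev (x : {set V}) : int := #|V|%:Z - 2 * #|x|%:Z.

Let sign (v : V) (x : {set V}) : int := if v \in x then -1 else 1.

Let toggle (v : V) (x : {set V}) : {set V} := [set u | (u \in x) (+) (u == v)].

Lemma devE x : dev x = \sum_v sign v x.
Proof.
rewrite /dev (bigID (mem x)) /=.
rewrite (eq_bigr (fun=> -1)) => [|v vx]; last by rewrite /sign vx.
rewrite [X in _ = _ + X](eq_bigr (fun=> 1)) => [|v vx]; last first.
  by rewrite /sign (negbTE vx).
have -> : \sum_(i | i \notin x) (1 : int) = \sum_(i in ~: x) 1.
  by apply: eq_bigl => i; rewrite inE.
rewrite !sumr_const mulNrn !natz; rewrite -(cardsC x) PoszD; ring.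
Qed.

(** Expand the square of the sum of signs: toggling [v] negates each mixed product, so only the
    diagonal remains. *)
Lemma sum_dev_sqr : \sum_x dev x ^+ 2 = (#|V| * 2 ^ #|V|)%N%:Z.
Proof.
have -> : \sum_x dev x ^+ 2 = \sum_v \sum_u \sum_x sign v x * sign u x.
  rewrite (eq_bigr (fun x => \sum_v \sum_u sign v x * sign u x)); last first.
    move=> x _; rewrite devE expr2 mulr_suml; apply: eq_bigr => v _.
    by rewrite mulr_sumr.
  by rewrite exchange_big; apply: eq_bigr => v _; rewrite exchange_big.
have toggleK v : involutive (toggle v).
  by move=> x; apply/setP => u; rewrite !inE addbK.
have signT v u x : sign u (toggle v x) = (if u == v then - sign u x else sign u x).
  by rewrite /sign /toggle inE; case: eqVneq; case: (u \in x).
have inner v : \sum_u \sum_x sign v x * sign u x = (2 ^ #|V|)%N.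
  rewrite (bigD1 v) //= [X in _ + X]big1 => [|u uv]; last first.
    have : \sum_x sign v x * sign u x = - \sum_x sign v x * sign u x.
      rewrite {1}(reindex_inj (inv_inj (toggleK v))) -sumrN; apply: eq_bigr => x _.
      by rewrite !signT eqxx (negbTE uv) mulNr.
    by set S := \sum_x _; lia.
  rewrite addr0 (eq_bigr (fun=> 1)) => [|x _]; last by rewrite /sign; case: ifP.
  by rewrite sumr_const card_sets natz.
by rewrite (eq_bigr _ (fun v _ => inner v)) sumr_const -mulr_natl natz PoszM.
Qed.

Definition lower_middle : {set {set V}} :=
  [set x : {set V} | (2 * #|x| <= #|V|)%N && ((#|V| - 2 * #|x|) ^ 2 <= 2 * #|V|)%N].

(** By Chebyshev's inequality at least half of the sets satisfy [dev x ^+ 2 <= 2 * #|V|];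
    complementation sends those above the middle to those below, so the lower ones are at least a
    quarter. *)
Lemma card_lower_middle : (2 ^ #|V| <= 4 * #|lower_middle|)%N.
Proof.
have [V0|Vgt0] := posnP #|V|.
  rewrite V0 muln_gt0 /=; apply/card_gt0P; exists set0.
  by rewrite inE cards0 V0.
pose far := [set x | (2 * #|V|)%:Z < dev x ^+ 2].
have far_le : (2 * #|far| <= 2 ^ #|V|)%N.
  rewrite -(leq_pmul2l Vgt0) -lez_nat -sum_dev_sqr.
  apply: (@le_trans _ _ (\sum_(x in far) (2 * #|V|)%N%:Z)).
    by rewrite sumr_const -mulr_natl natz; lia.
  rewrite [leRHS](bigID (mem far)) /= -[leLHS]addr0 lerD //.
    by apply: ler_sum => x; rewrite inE => /ltW.
  by apply: sumr_ge0 => x _; rewrite sqr_ge0.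
have cover : ~: far \subset lower_middle :|: [set ~: x | x in lower_middle].
  apply/subsetP => x; rewrite 3!inE -leNgt => dx.
  have cx := cardsC x; have [le|gt] := leqP (2 * #|x|) #|V|.
    apply/orP; left; rewrite inE; apply/andP; split=> //.
    by move: dx; rewrite /dev; nia.
  apply/orP; right; apply/imsetP; exists (~: x); last by rewrite setCK.
  rewrite inE; move: dx; rewrite /dev => dx; apply/andP; split; first by lia.
  by nia.
have : (2 ^ #|V| <= #|far| + (#|lower_middle| + #|lower_middle|))%N.
  rewrite -card_sets -(cardsC far) leq_add2l.
  apply: leq_trans (subset_leq_card cover) _.
  apply: leq_trans (leq_card_setU _ _) _.
  by rewrite leq_add2l leq_imset_card.
by lia.
Qed.

End MiddleLayers.

(** * Probabilities of separation and of witnesses *)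

Lemma blocks_count_ge (m s t k : nat) : m <= 4 * (s - t - k) ->
  s ^ t * (m ^ k * m ^ k) <= 16 ^ k * (s ^ t * ((s - t) ^ k * (s - t - k) ^ k)).
Proof.
move=> m_le; rewrite [leqRHS]mulnCA leq_mul2l; apply/orP; right.
have -> : 16 ^ k = 4 ^ k * 4 ^ k by rewrite -expnMn.
rewrite [leqRHS]mulnACA; apply: leq_mul; rewrite -expnMn; apply: leq_exp => //.
by apply: leq_trans m_le _; rewrite leq_mul2l leq_subr.
Qed.

Section Probabilities.
Variables (R : realType) (V : finType) (t k : nat).
Hypotheses (t2 : 1 < t) (k0 : 0 < k) (kt : k <= t) (tV : 16 * t ^ 2 <= #|V|).
Local Open Scope ring_scope.

(** With [2 ^ t.-1] terms, a set of half the size contains half a term on average. *)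
Let config : finType := {ffun 'I_(2 ^ t.-1) -> region V t k}.

Let Vgt0 : 0 < #|V|%:R :> R.
Proof.
by rewrite ltr0n; apply: (leq_trans _ tV); rewrite muln_gt0 expn_gt0 (ltnW t2).
Qed.

Let card_configE :
  #|config| = ((#|V| ^ t * (#|V| ^ k * #|V| ^ k)) ^ (2 ^ t.-1).-1.+1)%N.
Proof. by rewrite card_ffun card_ord card_region prednK // expn_gt0. Qed.

Let two_pow_t : 2 ^+ t = 2 * (2 ^ t.-1)%:R :> R.
Proof. by rewrite natrX -exprS prednK // ltnW. Qed.

(** Let [d] be the density of [x :\: y]. As [x] is live, [x :&: y] has density at most [1 / 2 - d],
    and the union bound over regions and two blocks gives [2 ^ t * (1 / 2 - d) ^ t * d ^ k], to
    which [pow_mul_pow_le] applies. *)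
Lemma card_separated_bound (x y : {set V}) : live x ->
  #|[set w : config |
     [exists i, separated (terms w) (blocks1 w) (blocks2 w) x y i]]|%:R <=
  (k%:R / (2 * t%:R)) ^+ k * #|config|%:R :> R.
Proof.
move=> lx; have := card_separated_le t k 'I_(2 ^ t.-1) x y.
rewrite -(ler_nat R) => /le_trans; apply.
rewrite card_configE card_ord card_region expnS !natrM !natrX.
have := cardsID y x; rewrite [in LHS]setIC [y :&: x]setIC => xE.
move: lx; rewrite /live -xE mulnDr -(ler_nat R) natrD !natrM.
set s := #|x :&: y|%:R; set u := #|x :\: y|%:R; set M := #|V|%:R => su.
have s_ge0 : 0 <= s :> R by [].
have u_ge0 : 0 <= u :> R by [].
have M_gt0 : 0 < M by [].
rewrite -/M; set P := _ ^+ (2 ^ t.-1).-1.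
have P_ge0 : 0 <= P by rewrite !exprn_ge0 // !mulr_ge0 // !exprn_ge0 // ltW.
have -> : 2 ^+ t.-1 * (s ^+ t * (2 * (u ^+ k * M ^+ k)) * P) =
    (2 * s) ^+ t * u ^+ k * (M ^+ k * P).
  by rewrite exprMn two_pow_t natrX; ring.
have -> (b : R) : b * (M ^+ t * (M ^+ k * M ^+ k) * P) =
    b * (M ^+ t * M ^+ k) * (M ^+ k * P) by ring.
apply: ler_wpM2r; first by rewrite mulr_ge0 // exprn_ge0 // ltW.
have d_ge0 : 0 <= u / M by rewrite divr_ge0 // ltW.
have d_le : 2 * (u / M) <= 1 by rewrite mulrA ler_pdivrMr //; lra.
have := pow_mul_pow_le (ltnW t2) k0 d_ge0 d_le.
have MM_gt0 : 0 < M ^+ t * M ^+ k by rewrite mulr_gt0 // exprn_gt0.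
move=> /(ler_wpM2r (ltW MM_gt0)) bound; apply: le_trans bound.
have -> : (1 - 2 * (u / M)) ^+ t * (u / M) ^+ k * (M ^+ t * M ^+ k) =
    ((1 - 2 * (u / M)) * M) ^+ t * ((u / M) * M) ^+ k by rewrite !exprMn; ring.
rewrite divfK ?gt_eqF // ler_wpM2r ?exprn_ge0 //.
rewrite lerXn2r ?nnegrE ?mulr_ge0 ?subr_ge0 ?(ltW M_gt0) //.
by rewrite mulrBl mul1r -mulrA divfK ?gt_eqF //; lra.
Qed.

(** Let [p] be the probability that a term lies in [x] and [L] the number of regions. A witness has
    probability at least [L * p * (1 - p) ^ (L - 1) / 16 ^ k], where [L * p >= 1 / 4] and the power
    of [1 - p] is at least [1 / 2]. *)
Lemma card_witness_bound (x : {set V}) : x \in lower_middle V ->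
  #|config|%:R <= (8 * 16 ^+ k) *
  #|[set w : config | witness (terms w) (blocks1 w) (blocks2 w) x]|%:R :> R.
Proof.
rewrite inE => /andP[lx dev].
(* The square of the left side is at most [8 * t ^ 2 * #|V|], and [16 * t ^ 2 <= #|V|]. *)
have t_dev : (2 * t * (#|V| - 2 * #|x|) <= #|V|)%N.
  rewrite -leq_sqr !expnMn.
  apply: (@leq_trans (2 ^ 2 * t ^ 2 * (2 * #|V|))); first by rewrite leq_mul2l dev orbT.
  nia.
(* Each of the [2 * k] block coordinates thus keeps a quarter of its choices, whence the loss
   [16 ^ k]. *)
have dim_le : (#|V| <= 4 * (#|x| - t - k))%N by nia.
have := @card_witness_ge V t k 'I_(2 ^ t.-1) x k0 lx.
rewrite card_configE card_region card_ord.
set count := #|[set w | _]|; set N := (#|x| ^ t * (#|V| ^ k * #|V| ^ k))%N.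
set W := (#|V| ^ t * _)%N => wit.
set L := (2 ^ t.-1)%N; rewrite -/L in wit.
have N_le : (N <= 16 ^ k * (#|x| ^ t * ((#|x| - t) ^ k * (#|x| - t - k) ^ k)))%N.
  exact: blocks_count_ge dim_le.
have wit_ge : (8 * (L * N * (W - N) ^ L.-1) <= 8 * 16 ^ k * count)%N.
  rewrite -[leqRHS]mulnA leq_mul2l; apply/orP; right.
  apply: leq_trans (leq_mul (leqnn (16 ^ k)%N) wit).
  rewrite [leqRHS](_ : _ = L * (16 ^ k * (#|x| ^ t * ((#|x| - t) ^ k *
    (#|x| - t - k) ^ k))) * (W - N) ^ L.-1)%N; last by ring.
  by rewrite leq_mul2r leq_mul2l N_le !orbT.
rewrite -[8]/(8%:R) -[16]/(16%:R) -natrX -!natrM.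
apply: le_trans (_ : (8 * (L * N * (W - N) ^ L.-1))%:R <= _); last by rewrite ler_nat.
have N_le_W : (N <= W)%N by rewrite leq_mul2r leq_exp ?orbT // max_card.
pose p : R := (#|x|%:R / #|V|%:R) ^+ t.
have NE : N%:R = W%:R * p.
  rewrite /N /W /p !natrM !natrX expr_div_n; field.
  by rewrite expf_neq0 // gt_eqF.
have q_ge0 : 0 <= 2 * (#|x|%:R / #|V|%:R) :> R by rewrite mulr_ge0 // divr_ge0.
have q_le1 : 2 * (#|x|%:R / #|V|%:R) <= 1 :> R.
  by rewrite mulrA ler_pdivrMr // mul1r -natrM ler_nat.
have LpE : 2 * (L%:R * p) = (2 * (#|x|%:R / #|V|%:R)) ^+ t.
  by rewrite exprMn two_pow_t mulrA.
(* [2 * L * p] is the [t]-th power of [2 * #|x| / #|V|], which by [t_dev] is at least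
   [1 - 1 / (2 * t)]. *)
have Lp_ge : 1 / 4 <= L%:R * p.
  suff : 1 - 1 / 2 <= 2 * (L%:R * p) by lra.
  rewrite LpE; set q := 2 * _ in q_ge0 q_le1 LpE *.
  have -> : q = 1 - (1 - q) by ring.
  apply: le_trans (bernoulli _ _); last by lra.
  rewrite lerD2l lerN2 /q.
  move: t_dev; rewrite -(ler_nat R) natrM natrB // !natrM => t_dev.
  rewrite -(ler_pM2r Vgt0).
  rewrite [leLHS](_ : _ = t%:R * (#|V|%:R - 2 * #|x|%:R)); last first.
    by field; rewrite gt_eqF.
  lra.
have Lp_le : L%:R * p <= 1 / 2.
  have : 2 * (L%:R * p) <= 1 by rewrite LpE exprn_ile1.
  lra.
have p_ge0 : 0 <= p by rewrite exprn_ge0 // divr_ge0.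
have p_le1 : p <= 1 by rewrite exprn_ile1 ?divr_ge0 //; lra.
have q_ge : 1 / 2 <= (1 - p) ^+ L.-1.
  apply: le_trans (bernoulli L.-1 _); last by rewrite p_ge0.
  have : L.-1%:R * p <= L%:R * p by rewrite ler_wpM2r // ler_nat leq_pred.
  lra.
clearbody N W L p; rewrite expnS !natrM !natrX natrB //.
rewrite NE -[X in (X - _)]mulr1 -mulrBr exprMn.
rewrite [leRHS](_ : _ = W%:R * W%:R ^+ L.-1 * (8 * (L%:R * p) * (1 - p) ^+ L.-1));
  last by ring.
rewrite ler_peMr ?mulr_ge0 ?exprn_ge0 //.
have : 1 / 4 * (1 / 2) <= L%:R * p * (1 - p) ^+ L.-1.
  by rewrite ler_pM //; lra.
lra.
Qed.
End Probabilities.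

(** * Reduction from testing *)

Section Testers.
Local Open Scope ring_scope.

(** For [w] in [G], the acceptance probabilities averaged over [s] differ by at least 1/3 between
    the two cases, while only algorithms bad for [w] contribute to the difference. So these have
    weight at least 1/3; sum over [w] and exchange the sums. *)
Lemma tester_indistinguishable_bound (R : realType) (n q : nat) (eps beta : R)
    (tester : nonadaptive_algorithm R n q) (Omega S : finType) (s0 : S)
    (fyes fno : Omega -> S -> boolfun n) (G : {set Omega})
    (bad : Omega -> det_algorithm n q -> bool) :
  tests_union_closed eps tester ->
  (forall w s, union_closed (fyes w s)) ->
  (forall w s, w \in G -> far_from_union_closed eps (fno w s)) ->
  (forall w D, ~~ bad w D ->
     (\sum_s det_accepts D (fyes w s))%N = (\sum_s det_accepts D (fno w s))%N) ->
  (forall D, #|[set w | bad w D]|%:R <= beta) ->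
  #|G|%:R <= 3 * beta.
Proof.
move=> [accept_yes reject_no] closed far coupled badle.
have Sgt0 : 0 < #|S|%:R :> R by rewrite ltr0n; apply/card_gt0P; exists s0.
have acceptE (f : boolfun n) :
    pr_accept tester f = \sum_D weight tester D * (det_accepts D f)%:R.
  rewrite /pr_accept big_mkcond; apply: eq_bigr => D _.
  by case: ifP; rewrite ?mulr1 ?mulr0.
have reject_accept (f : boolfun n) : pr_reject tester f = 1 - pr_accept tester f.
  apply/eqP; rewrite eq_sym subr_eq addrC -(weight_sum1 tester) /pr_accept.
  by rewrite (bigID (fun D => det_accepts D f)).
have sumE (f : S -> boolfun n) : \sum_s pr_accept tester (f s) =
    \sum_D weight tester D * (\sum_s det_accepts D (f s))%N%:R.
  under eq_bigr do rewrite acceptE.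
  rewrite exchange_big; apply: eq_bigr => D _.
  by rewrite -mulr_sumr natr_sum.
have le_bad w : w \in G -> 1 / 3 <= \sum_D weight tester D * (bad w D)%:R.
  move=> wG; rewrite -(ler_pM2r Sgt0).
  have yes_ge : 2 / 3 * #|S|%:R <= \sum_s pr_accept tester (fyes w s).
    rewrite mulr_natr -sumr_const; apply: ler_sum => s _.
    exact/accept_yes/closed.
  have no_le : \sum_s pr_accept tester (fno w s) <= 1 / 3 * #|S|%:R.
    rewrite mulr_natr -sumr_const; apply: ler_sum => s _.
    have := reject_no _ (far w s wG); rewrite reject_accept; lra.
  have : \sum_s pr_accept tester (fyes w s) <=
      \sum_s pr_accept tester (fno w s) +
      (\sum_D weight tester D * (bad w D)%:R) * #|S|%:R.
    rewrite !sumE mulr_suml -big_split; apply: ler_sum => D _ /=.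
    rewrite -mulrA -mulrDr ler_wpM2l ?weight_ge0 //.
    case: (boolP (bad w D)) => [_|/coupled->]; last by rewrite mul0r addr0.
    rewrite mul1r -natrD ler_nat (leq_trans _ (leq_addl _ _)) //.
    by rewrite -sum1_card leq_sum // => s _; case: det_accepts.
  lra.
have : \sum_(w in G) (1 / 3 : R) <= beta.
  apply: (@le_trans _ _ (\sum_w \sum_D weight tester D * (bad w D)%:R)).
    rewrite [leLHS]big_mkcond; apply: ler_sum => w _.
    case: ifP => [/le_bad//|_]; apply: sumr_ge0 => D _.
    by rewrite mulr_ge0 ?weight_ge0.
  rewrite exchange_big.
  have -> : beta = \sum_D weight tester D * beta.
    by rewrite -mulr_suml weight_sum1 mul1r.
  apply: ler_sum => D _; rewrite -mulr_sumr ler_wpM2l ?weight_ge0 //.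
  apply: le_trans (badle D).
  have -> : \sum_w (bad w D)%:R = (\sum_w bad w D)%N%:R :> R.
    by rewrite natr_sum.
  rewrite ler_nat -sum1dep_card.
  by rewrite [leqRHS]big_mkcond; apply: leq_sum => w _; case: (bad w D).
rewrite sumr_const -mulr_natr; lra.
Qed.

(** * The selector coordinate *)

Definition with_selector (m : nat) (F : bool -> {set 'I_m} -> bool) :
    boolfun m.+1 :=
  [ffun z : {set 'I_m.+1} => F (ord0 \in z) (lift ord0 @^-1: z)].

Definition add_selector (m : nat) (p : bool * {set 'I_m}) : {set 'I_m.+1} :=
  (if p.1 then [set ord0] else set0) :|: lift ord0 @: p.2.

Lemma add_selector_ord0 (m : nat) (p : bool * {set 'I_m}) :
  (ord0 \in add_selector p) = p.1.
Proof.
rewrite inE; have -> : ord0 \in lift ord0 @: p.2 = false.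
  by apply/negbTE/imsetP => -[j _ /eqP]; rewrite (negbTE (neq_lift _ _)).
by case: p => -[] x /=; rewrite ?inE.
Qed.

Lemma preim_add_selector (m : nat) (p : bool * {set 'I_m}) :
  lift ord0 @^-1: add_selector p = p.2.
Proof.
apply/setP => j; rewrite !inE (mem_imset _ _ lift_inj).
by case: p => -[] x /=; rewrite !inE // -(inj_eq val_inj).
Qed.

Lemma with_selectorE (m : nat) (F : bool -> {set 'I_m} -> bool)
    (p : bool * {set 'I_m}) :
  with_selector F (add_selector p) = F p.1 p.2.
Proof. by rewrite ffunE add_selector_ord0 preim_add_selector. Qed.

Lemma add_selectorU (m : nat) (c : bool) (x y : {set 'I_m}) :
  add_selector (c, x) :|: add_selector (c, y) = add_selector (c, x :|: y).
Proof. by rewrite /add_selector /= imsetU; case: c; rewrite ?set0U // setUUr. Qed.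

Lemma with_selector_union_closed (m : nat) (F : bool -> {set 'I_m} -> bool) :
  (forall c c' x y, F c x -> F c' y -> F (c || c') (x :|: y)) ->
  union_closed (with_selector F).
Proof.
by move=> FU x y; rewrite !ffunE inE preimsetU; apply: FU.
Qed.

Lemma card_cube (n : nat) : #|cube n| = (2 ^ n)%N.
Proof. by rewrite card_sets card_ord. Qed.

(** Fixing the selector bit of a union-closed function leaves a union-closed function, and
    [add_selector] is injective on disagreements. *)
Lemma with_selector_far (R : realType) (m d : nat)
    (F : bool -> {set 'I_m} -> bool) :
  (forall g : bool -> {set 'I_m} -> bool,
    (forall c x y, g c x -> g c y -> g c (x :|: y)) ->
    (d <= #|[set p : bool * {set 'I_m} | F p.1 p.2 != g p.1 p.2]|)%N) ->
  far_from_union_closed (d%:R / 2 ^+ m.+1 : R) (with_selector F).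
Proof.
move=> far g gU; rewrite /dist card_cube natrX ler_pM2r ?invr_gt0 ?exprn_gt0 //.
rewrite ler_nat; apply: (leq_trans (far (fun c x => g (add_selector (c, x))) _)).
  by move=> c x y gx gy; rewrite -add_selectorU; apply: gU.
have inj : injective (@add_selector m).
  move=> [c x] [c' y] e.
  have := preim_add_selector (c, x); have := add_selector_ord0 (c, x).
  by rewrite e add_selector_ord0 preim_add_selector /= => -> ->.
rewrite -(card_imset _ inj); apply/subset_leq_card/subsetP => z.
by case/imsetP => -[c x]; rewrite !inE => neq ->; rewrite with_selectorE.
Qed.

End Testers.

(** * The query bound for given [t] and [k] *)

Section QueryBound.
Variables (R : realType) (m t k : nat).
Hypotheses (t2 : 1 < t) (k0 : 0 < k) (kt : k <= t) (tm : 16 * t ^ 2 <= m).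

Let config : finType := {ffun 'I_(2 ^ t.-1) -> region 'I_m t k}.

Let witnesses (w : config) : {set {set 'I_m}} :=
  [set x | witness (terms w) (blocks1 w) (blocks2 w) x].

(** The threshold is half of the lower bound [2 ^ m / (32 * 16 ^ k)] on the average number of
    witnesses: a quarter of the sets, each with probability at least [1 / (8 * 16 ^ k)]. *)
Let good : {set config} := [set w | 2 ^ m <= 64 * 16 ^ k * #|witnesses w|].

Lemma card_good : #|config| <= 64 * 16 ^ k * #|good|.
Proof.
have total : \sum_w #|witnesses w| =
    \sum_x #|[set w : config | witness (terms w) (blocks1 w) (blocks2 w) x]|.
  under eq_bigr do rewrite card_set_sum.
  by rewrite exchange_big; apply: eq_bigr => x _; rewrite card_set_sum.
have tV : 16 * t ^ 2 <= #|'I_m| by rewrite card_ord.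
have lower : #|lower_middle 'I_m| * #|config| <=
    8 * 16 ^ k * \sum_w #|witnesses w|.
  rewrite total -sum_nat_const big_distrr [leqRHS](bigID (mem (lower_middle 'I_m))).
  apply: leq_trans (leq_addr _ _); apply: leq_sum => x xm.
  rewrite -(ler_nat R) !natrM natrX.
  exact: (card_witness_bound R t2 k0 kt tV xm).
have upper : 64 * 16 ^ k * \sum_w #|witnesses w| <=
    64 * 16 ^ k * #|good| * 2 ^ m + #|config| * 2 ^ m.
  have -> : #|config| * 2 ^ m = \sum_(w : config) 2 ^ m by rewrite sum_nat_const.
  have -> : 64 * 16 ^ k * #|good| * 2 ^ m =
      \sum_w (if w \in good then 64 * 16 ^ k * 2 ^ m else 0).
    by rewrite -big_mkcond sum_nat_const mulnAC mulnC.
  rewrite big_distrr -big_split /=.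
  apply: leq_sum => w _; case: ifPn => [wg|].
    apply: leq_trans (leq_addr _ _).
    rewrite leq_mul2l; apply/orP; right.
    by apply: leq_trans (max_card _) _; rewrite card_sets card_ord.
  by rewrite inE -ltnNge add0n => /ltnW.
have := card_lower_middle 'I_m; rewrite card_ord => mid.
have pos : 0 < 2 ^ m by rewrite expn_gt0.
rewrite -(leq_pmul2r pos).
set S := \sum_w _ in lower upper; set G := #|good| in upper *.
set C := #|config| in lower upper *; set K := 16 ^ k in lower upper *.
set LM := #|lower_middle _| in mid lower; move: mid lower upper pos.
set N := 2 ^ m; clearbody S G C K LM N; clear; nia.
Qed.

Local Open Scope ring_scope.

(** Good configurations have a share of at least [1 / (64 * 16 ^ k)], but at most three times the
    probability that some pair of queries clashes. The factor [16 ^ k] turns [k / (2 * t)] into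
    [8 * k / t]. *)
Lemma query_bound (q : nat) (eps : R) (tester : nonadaptive_algorithm R m.+1 q) :
  eps <= (128 * 16 ^+ k)^-1 -> tests_union_closed eps tester ->
  1 <= 192 * q%:R ^+ 2 * (8 * k%:R / t%:R) ^+ k :> R.
Proof.
move=> eps_le testing.
pose B : finType := {ffun 'I_(2 ^ t.-1) -> bool}.
pose F mode (w : config) (b : B) : boolfun m.+1 :=
  with_selector (talagrand (terms w) (blocks1 w) (blocks2 w) mode b).
pose rest (z : {set 'I_m.+1}) : {set 'I_m} := lift ord0 @^-1: z.
pose clash (w : config) (x y : {set 'I_m}) := [&& live x, live y &
  [exists i, separated (terms w) (blocks1 w) (blocks2 w) x y i]].
pose bad (w : config) (D : det_algorithm m.+1 q) :=
  [exists a, exists b, clash w (rest (tnth D.1 a)) (rest (tnth D.1 b))].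
have tm' : (16 * t ^ 2 <= #|'I_m|)%N by rewrite card_ord.
have ord_nonempty (f : {ffun 'I_k -> 'I_m}) : f @: [set: 'I_k] != set0.
  by apply/set0Pn; exists (f (Ordinal k0)); apply: imset_f.
pose beta : R := q%:R ^+ 2 * ((k%:R / (2 * t%:R)) ^+ k * #|config|%:R).
have badle D : #|[set w | bad w D]|%:R <= beta.
  have pairle a b : #|[set w | clash w (rest (tnth D.1 a)) (rest (tnth D.1 b))]|%:R
      <= (k%:R / (2 * t%:R)) ^+ k * #|config|%:R :> R.
    case: (boolP (live (rest (tnth D.1 a)))) => [la|/negbTE nla]; last first.
      rewrite [X in X%:R <= _](_ : _ = 0%N); last first.
        by apply/eqP; rewrite cards_eq0; apply/eqP/setP => w; rewrite !inE /clash nla.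
      by rewrite mulr_ge0 // exprn_ge0 // divr_ge0 // mulr_ge0.
    apply: le_trans (card_separated_bound R t2 k0 tm' (rest (tnth D.1 b)) la).
    rewrite ler_nat; apply/subset_leq_card/subsetP => w; rewrite !inE.
    by case/and3P.
  apply: (@le_trans _ _ (\sum_(a < q) \sum_(b < q)
      #|[set w | clash w (rest (tnth D.1 a)) (rest (tnth D.1 b))]|)%N%:R).
    rewrite ler_nat; apply: leq_trans (card_exists_le _) _.
    by apply: leq_sum => a _; apply: card_exists_le.
  rewrite natr_sum /beta expr2 -mulrA mulr_natl -[X in _ *+ X]card_ord -sumr_const.
  apply: ler_sum => a _.
  rewrite natr_sum mulr_natl -[X in _ *+ X]card_ord -sumr_const.
  by apply: ler_sum => b _.
have closed w b : union_closed (F false w b).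
  by apply: with_selector_union_closed => c c' x y; apply: talagrand_union_closed.
have far w b : w \in good -> far_from_union_closed eps (F true w b).
  rewrite inE => wgood g gU.
  have far_w : far_from_union_closed (#|witnesses w|%:R / 2 ^+ m.+1 : R) (F true w b).
    apply: with_selector_far => g' g'U.
    by apply: card_witness_le => // i; apply: ord_nonempty.
  apply: le_trans (far_w g gU).
  apply: le_trans eps_le _.
  rewrite ler_pdivlMr ?exprn_gt0 // -ler_pdivlMl ?invr_gt0 ?mulr_gt0 ?exprn_gt0 //.
  rewrite invrK; move: wgood; rewrite -(ler_nat R) !natrM !natrX exprS; lra.
have coupled w D : ~~ bad w D ->
    (\sum_b det_accepts D (F false w b))%N = (\sum_b det_accepts D (F true w b))%N.
  move=> nbad; pose s := [seq rest z | z <- D.1].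
  (* For fixed regions and queries, flipping permutes the bit vectors [b], so the number of accepted
     functions can be compared term by term. *)
  rewrite [RHS](reindex_inj
    (inv_inj (flipsK (terms w) (blocks1 w) (blocks2 w) s))).
  apply: eq_bigr => b _; congr (nat_of_bool (D.2 _)); apply: val_inj => /=.
  apply/eq_in_map => z zD; rewrite /F !ffunE talagrand_flips //; last first.
    by apply: map_f.
  move=> x y i /mapP[u /tnthP[a ->] ->] /mapP[v /tnthP[a' ->] ->] lx ly.
  move: nbad; rewrite negb_exists => /forallP/(_ a).
  rewrite negb_exists => /forallP/(_ a').
  by rewrite /clash lx ly negb_exists => /forallP/(_ i).
have := tester_indistinguishable_bound [ffun=> true] testing closed far coupled badle.
have config_gt0 : 0 < #|config|%:R :> R.
  have m0 : (0 < m)%N by apply: (leq_trans _ tm); rewrite muln_gt0 expn_gt0 (ltnW t2).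
  by rewrite ltr0n card_ffun card_region !card_ord !(expn_gt0, muln_gt0) m0.
have := card_good; rewrite -(ler_nat R) !natrM natrX => good_ge good_le.
have := le_trans good_ge (ler_wpM2l _ good_le).
rewrite mulr_ge0 ?exprn_ge0 // => /(_ isT).
have -> : 64 * 16 ^+ k * (3 * beta) =
    192 * q%:R ^+ 2 * (8 * k%:R / t%:R) ^+ k * #|config|%:R.
  have -> : 8 * k%:R / t%:R = 16 * (k%:R / (2 * t%:R)) :> R.
    by field; rewrite pnatr_eq0 -lt0n ltnW.
  by rewrite /beta; set r := _ / (2 * _); rewrite [(16 * r) ^+ k]exprMn; ring.
by rewrite -[leLHS]mul1r ler_pM2r.
Qed.
End QueryBound.

(** * Powers of 2 and choice of the parameters *)

Local Open Scope ring_scope.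

Lemma query_bound_pos (R : realType) (n t k q : nat) (eps : R)
    (tester : nonadaptive_algorithm R n q) :
  (0 < n)%N -> (1 < t)%N -> (0 < k)%N -> (k <= t)%N -> (16 * t ^ 2 <= n.-1)%N ->
  eps <= (128 * 16 ^+ k)^-1 -> tests_union_closed eps tester ->
  1 <= 192 * q%:R ^+ 2 * (8 * k%:R / t%:R) ^+ k :> R.
Proof.
case: n tester => [//|m] tester _ t2 k0 kt tm eps_le testing.
exact: (query_bound t2 k0 kt tm eps_le testing).
Qed.

Lemma truncn_half (R : realType) (x : R) : 1 <= x ->
  (Num.truncn x)%:R <= x <= 2 * (Num.truncn x)%:R.
Proof.
move=> x1; have /andP[le lt] : (Num.truncn x)%:R <= x < (Num.truncn x).+1%:R.
  by apply: truncn_itv; apply: le_trans x1.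
rewrite le (le_trans (ltW lt)) // -natr1 mulr_natl mulr2n lerD2l.
by rewrite ler1n truncn_gt0.
Qed.

Lemma log2K (R : realType) (x : R) : 0 < x -> 2 `^ (log2 x) = x.
Proof.
move=> x0; apply: ln_inj; rewrite ?posrE ?powR_gt0 // ln_powR divfK //.
by rewrite gt_eqF // ln_gt0 // ltr1n.
Qed.

Lemma ler_pow2 (R : realType) (x y : R) : (2 `^ x <= 2 `^ y) = (x <= y).
Proof.
rewrite -[LHS]ler_ln ?posrE ?powR_gt0 // !ln_powR ler_pM2r //.
by rewrite ln_gt0 // ltr1n.
Qed.

Lemma ltr_pow2 (R : realType) (x y : R) : (2 `^ x < 2 `^ y) = (x < y).
Proof. by rewrite !ltNge ler_pow2. Qed.

Lemma pow2_affine (R : realType) (k : nat) :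
  2 `^ (7 + 4 * k%:R) = 128 * 16 ^+ k :> R.
Proof.
rewrite powRD ?powRrM ?powR_mulrn ?exprn_ge0 //; last first.
  by rewrite pnatr_eq0 implybT.
have -> : 2 ^+ 7 = 128 :> R by rewrite -natrX.
by have -> : 2 ^+ 4 = 16 :> R by rewrite -natrX.
Qed.

(** The spare factor [2 ^ k] is at least 256 and absorbs the constant 192. *)
Lemma pow_le_sqr (R : realType) (k : nat) (s x y : R) : (8 <= k)%N -> 0 < s ->
  0 <= x -> x <= (2 * s)^-1 -> 1 <= 192 * y ^+ 2 * x ^+ k -> s ^+ k <= y ^+ 2.
Proof.
move=> k8 s0 x0 xs bound; have s20 : 0 < 2 * s by rewrite mulr_gt0.
have pow_le : 2 ^+ k * s ^+ k <= 192 * y ^+ 2.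
  rewrite -exprMn -[leLHS]mul1r -ler_pdivlMr ?exprn_gt0 // -exprVn.
  apply: le_trans bound _; apply: ler_wpM2l.
    by apply: mulr_ge0; [rewrite ler0n|apply: sqr_ge0].
  by rewrite lerXn2r ?nnegrE ?invr_ge0 // ltW.
have two_pow : 192 <= 2 ^+ k :> R.
  apply: (@le_trans _ _ (2 ^+ 8)); first by rewrite -natrX ler_nat.
  by rewrite ler_eXn2l // ltr1n.
have y192 : 0 < 192 :> R by rewrite ltr0n.
rewrite -(ler_pM2l y192); apply: le_trans pow_le.
by rewrite ler_wpM2r // exprn_ge0 // ltW.
Qed.

Lemma sqr_le_of_eighth (R : realFieldType) (x y : R) :
  0 <= x -> x <= y / 8 -> 1 <= y / 8 -> 16 * x ^+ 2 + 1 <= y ^+ 2.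
Proof.
have [z ->] : exists z, y = z * 8 by exists (y / 8); field.
rewrite mulfK ?pnatr_eq0 // => x0 xz z1; nra.
Qed.

Lemma pow_root (R : realType) (a : R) (k : nat) :
  (a `^ (1 / 100)) ^+ k = (a `^ (k%:R / 200)) ^+ 2.
Proof.
have -> : k%:R / 200 = 1 / 100 * k%:R / 2 :> R by lra.
set x := 1 / 100 * _; rewrite -[LHS]powR_mulrn ?powR_ge0 // -[LHS]powRrM -/x.
by rewrite -[RHS]powR_mulrn ?powR_ge0 // -[RHS]powRrM divfK ?pnatr_eq0.
Qed.

Theorem theorem1p4 (R : realType) :
  exists c : R, 0 < c /\
  exists kappa : R, 0 < kappa /\
  forall (n : nat) (eps : R),
    2 `^ (- (n%:R `^ (49 / 100))) <= eps -> eps < c ->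
    forall (q : nat) (T : nonadaptive_algorithm R n q),
      tests_union_closed eps T ->
      n%:R `^ (kappa * log2 (1 / eps)) <= q%:R.
Proof.
(* This ensures [l / 256 > 8], hence [8 <= k]. *)
exists (2 `^ (- (8 * 256))); split; first exact: powR_gt0.
(* The factors come from [k ~ l / 256], from rounding [k] down, and from [s ^ k <= q ^ 2] with
   [s = n ^ (1 / 100)]. *)
exists (256^-1 / 2 / 200); split; first by rewrite !divr_gt0 ?invr_gt0 ?ltr0n.
move=> n eps eps_ge eps_lt q tester testing.
have eps_gt0 : 0 < eps by apply: lt_le_trans eps_ge; apply: powR_gt0.
set l := log2 (1 / eps); set h := n%:R `^ (49 / 100) in eps_ge.
have epsE : eps = 2 `^ (- l).
  by rewrite powRN log2K ?divr_gt0 // div1r invrK.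
have l_le : l <= h by rewrite epsE ler_pow2 lerN2 in eps_ge.
have l_gt : 8 * 256 < l by rewrite epsE ltr_pow2 ltrN2 in eps_lt.
have C_gt0 : 0 < 256 :> R by rewrite ltr0n.
have l8 : 8 <= l / 256 by rewrite ler_pdivlMr // ltW.
have h_ge8 : 8 <= h.
  apply: le_trans l_le; apply: le_trans (ltW l_gt).
  by apply: ler_peMr; rewrite ?ler0n ?ler1n.
have n_gt0 : (0 < n)%N.
  rewrite lt0n; apply: contraTneq h_ge8 => n0.
  rewrite /h n0 powR0 ?mulf_neq0 ?invr_eq0 ?pnatr_eq0 //.
  by rewrite -ltNge ltr0n.
(* The gap [s] between [h], which bounds [l], and the square root of [n] makes [k / t] polynomially
   small. *)
pose rho : R := n%:R `^ (1 / 2); pose s : R := n%:R `^ (1 / 100).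
have nR_gt0 : 0 < n%:R :> R by rewrite ltr0n.
have s_gt0 : 0 < s by rewrite powR_gt0.
have rhoE : rho = h * s.
  rewrite /rho /h /s -powRD; last by rewrite (gt_eqF nR_gt0) implybT.
  by congr (_ `^ _); lra.
have rho_sqr : rho ^+ 2 = n%:R.
  by rewrite -powR_mulrn ?powR_ge0 // -powRrM divfK ?powRr1 // pnatr_eq0.
have h_le_rho : h <= rho by apply: ler_powR; [rewrite ler1n|lra].
pose k := Num.truncn (l / 256); pose t := Num.truncn (rho / 8).
have /andP[k_le k_ge] : k%:R <= l / 256 <= 2 * k%:R.
  by apply: truncn_half; apply: le_trans l8; rewrite ler1n.
have k8 : (8 <= k)%N by rewrite truncn_ge_nat ?(le_trans _ l8).
have h256 : 8 * 256 <= rho.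
  by apply: le_trans h_le_rho; apply: le_trans l_le; apply: ltW.
have [rho_ge1 k8R] : 1 <= rho / 8 /\ 8 <= k%:R :> R.
  by split; [lra|rewrite ler_nat].
have /andP[t_le t_ge] := truncn_half rho_ge1; rewrite -/t in t_le t_ge.
have tR_ge : 128 <= t%:R :> R by lra.
have t_ge2 : (1 < t)%N.
  by rewrite -(ler_nat R); apply: le_trans tR_ge; rewrite ler_nat.
have kt : (k <= t)%N by rewrite -(ler_nat R); lra.
(* From [k <= h / 256] and [t >= rho / 16] the ratio is at most [h / (2 * rho)]. *)
have ratio : 8 * k%:R / t%:R <= (2 * s)^-1.
  have t_gt0 : 0 < t%:R :> R by rewrite ltr0n ltnW.
  rewrite ler_pdivrMr // [leRHS]mulrC ler_pdivlMr ?mulr_gt0 //.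
  have : k%:R * s <= h / 256 * s.
    by rewrite ler_pM2r // (le_trans k_le) // ler_pM2r ?invr_gt0.
  rewrite mulrAC -rhoE; lra.
have eps_le : eps <= (128 * 16 ^+ k)^-1.
  rewrite epsE powRN -pow2_affine lef_pV2 ?posrE ?powR_gt0 // ler_pow2.
  rewrite ler_pdivlMr // in k_le; lra.
have tn : (16 * t ^ 2 <= n.-1)%N.
  rewrite -ltnS prednK // -addn1 -(ler_nat R) natrD natrM natrX -rho_sqr.
  exact: sqr_le_of_eighth.
have sk_le : s ^+ k <= q%:R ^+ 2.
  apply: (pow_le_sqr k8 s_gt0 _ ratio); first by rewrite divr_ge0 ?mulr_ge0.
  exact: (query_bound_pos n_gt0 t_ge2 (leq_trans _ k8) kt tn eps_le testing).
have skE : s ^+ k = (n%:R `^ (k%:R / 200)) ^+ 2 by apply: pow_root.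
have exponent_le : 256^-1 / 2 / 200 * l <= k%:R / 200.
  rewrite mulrC !mulrA ler_pM2r ?invr_gt0 ?ltr0n //.
  by rewrite ler_pdivrMr ?ltr0n // [leRHS]mulrC.
apply: (@le_trans _ _ (n%:R `^ (k%:R / 200))).
  by apply: ler_powR; rewrite ?ler1n.
by move: sk_le; rewrite skE ler_pXn2r ?nnegrE ?powR_ge0.
Qed.
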